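(* Let $u\in L_{2,\mathrm{loc}}({\mathbb R}^3;{\mathbb C}^3)$ satisfy $\operatorname{curl} u=0$. Then $I_u=0$, i.e. $I_u f=P(u\times f)=0$ for every $f\in G_0$.
   Context: Notation: $\partial\varphi$ is the gradient of a scalar function $\varphi$; $\times$ is the vector product in ${\mathbb C}^3$ (extended complex-bilinearly from ${\mathbb R}^3$). Let $G_0=\{\partial\varphi \mid \varphi\in C_0^\infty({\mathbb R}^3)\}$, with $C_0^\infty({\mathbb R}^3)$ the (complex-valued) smooth compactly supported functions, and let $G$ be the closure of $G_0$ in $L_2({\mathbb R}^3;{\mathbb C}^3)$. Let $P$ be the orthogonal projection of $L_2({\mathbb R}^3;{\mathbb C}^3)$ onto $G$. For $u\in L_{2,\mathrm{loc}}({\mathbb R}^3;{\mathbb C}^3)$ the linear operator $I_u:G_0\to G$ is defined by $I_u f=P(u\times f)$; this is well defined since $u\times f\in L_2({\mathbb R}^3;{\mathbb C}^3)$. For locally integrable $u$, the relation $\operatorname{curl}u=0$ is understood in the sense of distributions. *)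

(* Defs.v *)
From HB Require Import structures.
From mathcomp Require Import all_boot all_order all_algebra.
From mathcomp Require Import complex.
From mathcomp Require Import all_classical all_reals all_analysis.

Set Implicit Arguments.
Unset Strict Implicit.
Unset Printing Implicit Defensive.

Import Order.TTheory GRing.Theory Num.Theory.
Import numFieldNormedType.Exports.

Local Open Scope classical_set_scope.
Local Open Scope ring_scope.
Local Open Scope complex_scope.

Notation R3 R := (R * R * R)%type.

Notation field3 R := (R3 R -> 'rV[R[i]]_3).

Section fields.
Variable R : realType.
Implicit Types (f : R3 R -> R) (phi : R3 R -> R[i]) (h g u : field3 R).

(* Borel sigma-algebra; every Lebesgue-measurable function agrees almost
   everywhere with a Borel one. *)
Definition lebesgue3 : {measure set (R3 (measurableTypeR R)) -> \bar R} :=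
  ((@lebesgue_measure R \x @lebesgue_measure R) \x @lebesgue_measure R)%E.

Definition Cintegral phi : R[i] :=
  (\int[lebesgue3]_x complex.Re (phi x)) +i* (\int[lebesgue3]_x complex.Im (phi x)).

Definition Cmeasurable phi : Prop :=
  measurable_fun [set: R3 (measurableTypeR R)] (fun x => complex.Re (phi x)) /\
  measurable_fun [set: R3 (measurableTypeR R)] (fun x => complex.Im (phi x)).

Definition basis3 (k : 'I_3) : R3 R := ((k == 0)%:R, (k == 1)%:R, (k == 2)%:R).

Definition partial (k : 'I_3) f : R3 R -> R := fun x => 'D_(basis3 k) f x.

Definition iter_partial (s : seq 'I_3) f : R3 R -> R := foldr partial f s.

Definition smooth f : Prop :=
  forall s : seq 'I_3, continuous (iter_partial s f) /\
    forall (k : 'I_3) (x : R3 R), derivable (iter_partial s f) x (basis3 k).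

Definition Cpartial (k : 'I_3) phi : R3 R -> R[i] := fun x =>
  partial k (fun y => complex.Re (phi y)) x +i* partial k (fun y => complex.Im (phi y)) x.

Definition test_function phi : Prop :=
  [/\ smooth (fun x => complex.Re (phi x)), smooth (fun x => complex.Im (phi x)) &
      compact (closure [set x | phi x != 0])].

Definition grad phi : field3 R := fun x => \row_k Cpartial k phi x.

(* In the ring 'I_3, the indices k + 1 and k + 2 are taken modulo 3. *)
Definition cross (a b : 'rV[R[i]]_3) : 'rV[R[i]]_3 :=
  \row_k (a 0 (k + 1) * b 0 (k + 2) - a 0 (k + 2) * b 0 (k + 1)).

Definition dist_partial (k : 'I_3) (v : R3 R -> R[i]) phi : R[i] :=
  - Cintegral (fun x => v x * Cpartial k phi x).

Definition dist_curl u (k : 'I_3) phi : R[i] :=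
  dist_partial (k + 1) (fun x => u x 0 (k + 2)) phi -
  dist_partial (k + 2) (fun x => u x 0 (k + 1)) phi.

Definition curl_free u : Prop :=
  forall (k : 'I_3) phi, test_function phi -> dist_curl u k phi = 0.

Definition Cnorm3 (a : 'rV[R[i]]_3) : R :=
  Num.sqrt (\sum_k Normc.normc (a 0 k) ^+ 2).

Definition L2norm h : \bar R :=
  'N[lebesgue3]_2%:E[EFin \o (fun x => Cnorm3 (h x))]%E.

(* Elements of L_2(R^3; C^3) are represented by functions, and equality in
   L_2(R^3; C^3) by almost-everywhere equality. *)
Definition L2 : set (field3 R) := [set h : field3 R |
  (forall k, Cmeasurable (fun x => h x 0 k))
  /\ (L2norm h < +oo)%E].

Definition L2loc : set (field3 R) := [set u : field3 R |
  forall K : set (R3 R), compact K -> L2 (patch (fun=> 0) K u)].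

Definition L2inner h g : R[i] :=
  Cintegral (fun x => \sum_k h x 0 k * (g x 0 k)^*).

Definition L2closure (A : set (field3 R)) : set (field3 R) :=
  [set g : field3 R | L2 g /\ forall e : R, 0 < e -> exists2 f, A f &
     (L2norm (fun x => g x - f x)%R < e%:E)%E].

(* For h in L2 and a closed subspace A, such a g exists and is unique up to
   almost-everywhere equality.  If there is none, the value is h, not 0. *)
Definition orth_proj (A : set (field3 R)) h : field3 R :=
  xget h [set g : field3 R | A g /\ forall k, A k -> L2inner (fun x => h x - g x) k = 0].

Definition G0 : set (field3 R) :=
  [set grad phi | phi in test_function].

Definition G : set (field3 R) := L2closure G0.

Definition P : field3 R -> field3 R := orth_proj G.

Definition I_ u (f : field3 R) : field3 R :=
  P (fun x => cross (u x) (f x)).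

End fields.

(* Main.v *)
(* For f = grad phi and g = grad psi, put chi = conj psi.  Pointwise,
   (u x grad phi) . grad chi = u . (grad phi x grad chi) = u . curl (phi grad chi),
   because second partial derivatives commute.  The integral of the right-hand side
   is the sum over k of the distributions (curl u)_k evaluated at the test functions
   phi * d_k chi, hence it vanishes.  So u x f is orthogonal to G0, and to its closure
   G by a Cauchy-Schwarz estimate; its projection p onto G then satisfies <p, p> = 0. *)

Require Import Defs.
From HB Require Import structures.
From mathcomp Require Import all_boot all_order all_algebra.
From mathcomp Require Import complex.
From mathcomp Require Import all_classical all_reals all_analysis.
From mathcomp Require Import measurable_realfun ring lra.

Import Order.TTheory GRing.Theory Num.Theory.
Import numFieldNormedType.Exports.

Local Open Scope classical_set_scope.
Local Open Scope ring_scope.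
Local Open Scope complex_scope.

Set Implicit Arguments.
Unset Strict Implicit.
Unset Printing Implicit Defensive.

(** * Symmetry of second derivatives *)

(** Smoothness is given through iterated coordinate partials that exist and are continuous, so the
    symmetry of second derivatives is derived from the one-variable mean value theorem. The field
    [u] is merely locally square-integrable and cannot be differentiated; all derivatives fall on
    the product of [phi] and a partial of [chi], whose compact support comes from [phi]. Compact
    supports also make every product of [u] with a derivative integrable, which is what allows the
    integral of the sum to be split into distributions. Finally, [orth_proj] is a choice with its
    own argument as default value, so a valid candidate has to be exhibited before the chosen field
    is known to lie in [G]. *)

Section mixed_partials.
Variables (R : realType) (V : normedModType R).
Implicit Types (f : V -> R) (v w x : V).

(** The difference quotient of the restriction to the line coincides term by term with that of [f]
    along [v]; one-variable theorems thus apply to directional derivatives. *)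
Lemma is_derive_line f v x (s : R) : derivable f (s *: v + x) v ->
  is_derive s 1 (fun t : R => f (t *: v + x)) ('D_v f (s *: v + x)).
Proof.
move=> df.
have E : (fun h : R => h^-1 *: (((fun t : R => f (t *: v + x)) \o shift s) (h *: 1)
    - f (s *: v + x))) =
  (fun h : R => h^-1 *: ((f \o shift (s *: v + x)) (h *: v) - f (s *: v + x))).
  by apply/funext => h /=; rewrite scalerDl addrA [_%:A]mulr1.
by apply: DeriveDef; rewrite /derivable /derive E.
Qed.

Lemma derive_translate f v a x :
  (derivable (fun y => f (a + y)) x v <-> derivable f (a + x) v) /\
  'D_v (fun y => f (a + y)) x = 'D_v f (a + x).
Proof.
have E : (fun h : R => h^-1 *: (((fun y => f (a + y)) \o shift x) (h *: v)
    - f (a + x))) =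
  (fun h : R => h^-1 *: ((f \o shift (a + x)) (h *: v) - f (a + x))).
  by apply/funext => h /=; rewrite addrCA.
by split; rewrite /derivable /derive E.
Qed.

Lemma MVT_line f v x (h : R) : 0 < h -> (forall y, derivable f y v) ->
  exists2 c, 0 < c < h & f (h *: v + x) - f x = h * 'D_v f (c *: v + x).
Proof.
move=> h0 df.
have isd (s : R) := is_derive_line (df (s *: v + x)).
have := @MVT R (fun t => f (t *: v + x)) (fun s => 'D_v f (s *: v + x)) 0 h h0
  (fun s _ => isd s).
case=> [|c].
  apply: derivable_within_continuous => s _.
  exact: (@ex_derive _ _ _ _ _ _ _ (isd s)).
rewrite in_itv /= => ch; rewrite scale0r add0r subr0 mulrC => E.
by exists c.
Qed.

(** The second difference over a parallelogram is the first difference along [v] of the increment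
    [g] of [f] in the direction [w]. The mean value theorem is applied to [g] along [v], then to
    ['D_v f] along [w]. *)
Lemma second_difference f v w x (h : R) : 0 < h ->
  (forall y, derivable f y v) -> (forall y, derivable ('D_v f) y w) ->
  exists c, exists2 d, 0 < c < h /\ 0 < d < h &
  f (h *: w + (h *: v + x)) - f (h *: v + x) - (f (h *: w + x) - f x) =
  h * (h * 'D_w ('D_v f) (d *: w + (c *: v + x))).
Proof.
move=> h0 df ddf.
pose g y := f (h *: w + y) - f y.
have dt y : derivable (fun y => f (h *: w + y)) y v.
  by apply/(derive_translate f v (h *: w) y).1.
have dg y : derivable g y v by apply: derivableB.
have [c c0h E] := MVT_line x h0 dg.
have [d d0h E2] := MVT_line (c *: v + x) h0 ddf.
exists c, d => //.
rewrite -E2 -(derive_translate f v (h *: w) (c *: v + x)).2 -deriveB//.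
Qed.

(** If the two values differed, continuity would keep each mixed derivative within half the gap of
    its value near [x]; but the second difference equates a value of one with a value of the other
    at points arbitrarily close to [x]. *)
Lemma derive_swap f v w x :
  (forall y, derivable f y v) -> (forall y, derivable f y w) ->
  (forall y, derivable ('D_v f) y w) -> (forall y, derivable ('D_w f) y v) ->
  {for x, continuous ('D_w ('D_v f))} -> {for x, continuous ('D_v ('D_w f))} ->
  'D_w ('D_v f) x = 'D_v ('D_w f) x.
Proof.
move=> dv dw dvw dwv cvw cwv.
have subACA (a b c d : R) : a - b - (c - d) = a - c - (b - d) by ring.
have tri (a b y d : R) : `|a - y| < d / 2 -> `|b - y| < d / 2 -> `|a - b| < d.
  move=> ay bY; rewrite -(subrK y a) -addrA (le_lt_trans (ler_normD _ _))//.
  by rewrite [ltRHS]splitr ltrD// distrC.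
apply/eqP; rewrite -subr_eq0 -normr_eq0.
apply/negPn/negP => AB; set A := 'D_w _ x in AB *; set B := 'D_v _ x in AB *.
have e0 : 0 < `|A - B| / 2 by rewrite divr_gt0// lt0r AB normr_ge0.
move/cvgrPdist_lt: (cvw) => /(_ _ e0) /nbhs_normP[r1 /= r10 H1].
move/cvgrPdist_lt: (cwv) => /(_ _ e0) /nbhs_normP[r2 /= r20 H2].
(* The summand 1 makes [k] positive and exceed the sum of the two norms, so that steps below
   [h = r / k] along [v] and [w] stay strictly inside the ball of radius [r]. *)
pose r := Num.min r1 r2; pose k := `|v| + `|w| + 1.
have k0 : 0 < k by rewrite ltr_wpDl// addr_ge0.
have r0 : 0 < r by rewrite lt_min r10.
pose h := r / k; have h0 : 0 < h by rewrite divr_gt0.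
have near_x a b (p q : V) : 0 < a < h -> 0 < b < h -> `|p| + `|q| = `|v| + `|w| ->
    `|x - (a *: p + (b *: q + x))| < r.
  move=> /andP[a0 ah] /andP[b0 bh] pq.
  rewrite addrA opprD addrCA subrr addr0 normrN.
  apply: (@le_lt_trans _ _ (h * (`|v| + `|w|))).
    rewrite -pq mulrDr (le_trans (ler_normD _ _))//.
    by rewrite !normrZ !gtr0_norm// lerD// ler_wpM2r// ltW.
  rewrite /h -[ltRHS](divfK (lt0r_neq0 k0)) ltr_pM2l//.
  by rewrite /k ltrDl.
have [c [d [c0 d0] E1]] := second_difference x h0 dv dvw.
have [c' [d' [c'0 d'0] E2]] := second_difference x h0 dw dwv.
(* The second difference is symmetric in [v] and [w]. *)
have EE : 'D_w ('D_v f) (d *: w + (c *: v + x)) =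
    'D_v ('D_w f) (d' *: v + (c' *: w + x)).
  apply: (@mulfI _ h); first exact: lt0r_neq0.
  apply: (@mulfI _ h); first exact: lt0r_neq0.
  move: E1; rewrite [h *: w + (h *: v + x)]addrCA subACA => /esym E1.
  exact: etrans E1 E2.
have := H1 _ (lt_le_trans (near_x _ _ w v d0 c0 (addrC _ _)) (_ : r <= r1)).
rewrite ge_min lexx => /(_ isT) L1.
have := H2 _ (lt_le_trans (near_x _ _ v w d'0 c'0 erefl) (_ : r <= r2)).
rewrite ge_min lexx orbT => /(_ isT) L2.
rewrite /= -EE in L2.
by have := tri _ _ _ _ L1 L2; rewrite ltxx.
Qed.

End mixed_partials.

(** * Smooth functions and test functions *)

Section smooth_functions.
Variable R : realType.
Implicit Types (f g : R3 R -> R) (phi psi : R3 R -> R[i]) (k l : 'I_3).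

Lemma smooth_continuous f : smooth f -> continuous f.
Proof. by move=> sf; exact: (sf [::]).1. Qed.

Lemma smooth_derivable f k x : smooth f -> derivable f x (basis3 R k).
Proof. by move=> sf; exact: (sf [::]).2. Qed.

(** [foldr] applies the last index of the list first, so differentiating [partial k f] along [s] is
    differentiating [f] along [rcons s k]. *)
Lemma smooth_partial f k : smooth f -> smooth (partial k f).
Proof.
by move=> sf s; have := sf (rcons s k); rewrite /iter_partial foldr_rcons.
Qed.

(** Coinduction principle: [smooth] contains every class of continuous, partially derivable
    functions that is stable under [partial]. *)
Lemma smooth_coind (Q : (R3 R -> R) -> Prop) :
  (forall f, Q f -> continuous f) ->
  (forall f k x, Q f -> derivable f x (basis3 R k)) ->
  (forall f k, Q f -> Q (partial k f)) ->
  forall f, Q f -> smooth f.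
Proof.
move=> Qc Qd Qp f Qf s.
suff Qs : Q (iter_partial s f) by split=> [|k x]; [exact: Qc|exact: Qd].
by elim: s => //= k s; exact: Qp.
Qed.

(* This class is closed under [partial] by the Leibniz rule, which gives smoothness
   of sums and products at once, without a formula for iterated derivatives. *)
Inductive smooth_algebra : (R3 R -> R) -> Prop :=
| smooth_algebra_gen f : smooth f -> smooth_algebra f
| smooth_algebra_cst c : smooth_algebra (fun=> c)
| smooth_algebraD f g : smooth_algebra f -> smooth_algebra g ->
    smooth_algebra (fun x => f x + g x)
| smooth_algebraM f g : smooth_algebra f -> smooth_algebra g ->
    smooth_algebra (fun x => f x * g x).

Lemma partialD f g k x : derivable f x (basis3 R k) -> derivable g x (basis3 R k) ->
  partial k (fun y => f y + g y) x = partial k f x + partial k g x.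
Proof. exact: deriveD. Qed.

Lemma partialM f g k x : derivable f x (basis3 R k) -> derivable g x (basis3 R k) ->
  partial k (fun y => f y * g y) x = f x * partial k g x + g x * partial k f x.
Proof. exact: deriveM. Qed.

Lemma partial_cst c k : partial k (fun=> c) = (fun=> 0) :> (R3 R -> R).
Proof. by apply/funext => x; exact: derive_cst. Qed.

Lemma smooth_algebra_smooth f : smooth_algebra f -> smooth f.
Proof.
have der f' k x : smooth_algebra f' -> derivable f' x (basis3 R k).
  elim=> [g /smooth_derivable//|c|g h _ dg _ dh|g h _ dg _ dh].
  - exact: derivable_cst.
  - exact: derivableD.
  - exact: derivableM.
move: f; apply: smooth_coind => // [f|f k].
- elim=> [g /smooth_continuous//|c|g h _ cg _ ch|g h _ cg _ ch].
  + exact: cst_continuous.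
  + by move=> x; apply: cvgD; [exact: cg|exact: ch].
  + by move=> x; apply: cvgM; [exact: cg|exact: ch].
- elim=> [g sg|c|g h ag pg ah ph|g h ag pg ah ph].
  + exact/smooth_algebra_gen/smooth_partial.
  + by rewrite partial_cst; exact: smooth_algebra_cst.
  + rewrite (_ : partial _ _ = fun x => partial k g x + partial k h x).
      exact: smooth_algebraD.
    by apply/funext => x; rewrite partialD//; exact: der.
  + rewrite (_ : partial _ _ = fun x => g x * partial k h x + h x * partial k g x).
      by apply: smooth_algebraD; exact: smooth_algebraM.
    by apply/funext => x; rewrite partialM//; exact: der.
Qed.

Lemma smoothD f g : smooth f -> smooth g -> smooth (fun x => f x + g x).
Proof.
by move=> sf sg; apply/smooth_algebra_smooth/smooth_algebraD;
  exact: smooth_algebra_gen.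
Qed.

Lemma smoothM f g : smooth f -> smooth g -> smooth (fun x => f x * g x).
Proof.
by move=> sf sg; apply/smooth_algebra_smooth/smooth_algebraM;
  exact: smooth_algebra_gen.
Qed.

Lemma smooth_cst c : smooth (fun=> c : R).
Proof. exact/smooth_algebra_smooth/smooth_algebra_cst. Qed.

Lemma smoothN f : smooth f -> smooth (fun x => - f x).
Proof.
move=> sf; rewrite (_ : (fun x => - f x) = fun x => (-1) * f x).
  exact/smoothM/sf/smooth_cst.
by apply/funext => x; rewrite mulN1r.
Qed.

Lemma partialN f k x : smooth f -> partial k (fun y => - f y) x = - partial k f x.
Proof. by move=> sf; apply: deriveN; exact: smooth_derivable. Qed.

Lemma partialB f g k x : smooth f -> smooth g ->
  partial k (fun y => f y - g y) x = partial k f x - partial k g x.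
Proof. by move=> sf sg; apply: deriveB; exact: smooth_derivable. Qed.

Lemma partial_swap f k l x : smooth f ->
  partial k (partial l f) x = partial l (partial k f) x.
Proof.
move=> sf; apply: derive_swap => [y|y|y|y||].
- exact: smooth_derivable.
- exact: smooth_derivable.
- exact/smooth_derivable/smooth_partial.
- exact/smooth_derivable/smooth_partial.
- exact: (smooth_continuous (smooth_partial k (smooth_partial l sf))).
- exact: (smooth_continuous (smooth_partial l (smooth_partial k sf))).
Qed.

Definition Csmooth phi :=
  smooth (fun x => complex.Re (phi x)) /\ smooth (fun x => complex.Im (phi x)).

Lemma test_function_Csmooth phi : test_function phi -> Csmooth phi.
Proof. by case. Qed.

Lemma ReM (a b : R[i]) :
  complex.Re (a * b) = complex.Re a * complex.Re b - complex.Im a * complex.Im b.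
Proof. by case: a b => [? ?] []. Qed.

Lemma ImM (a b : R[i]) :
  complex.Im (a * b) = complex.Re a * complex.Im b + complex.Im a * complex.Re b.
Proof. by case: a b => [? ?] []. Qed.

Lemma Re_conj (a : R[i]) : complex.Re a^*%R = complex.Re a.
Proof. by case: a. Qed.

Lemma Im_conj (a : R[i]) : complex.Im a^*%R = - complex.Im a.
Proof. by case: a. Qed.

Lemma CsmoothM phi psi : Csmooth phi -> Csmooth psi ->
  Csmooth (fun x => phi x * psi x).
Proof.
move=> [rf jf] [rg jg]; split.
- under eq_fun do rewrite ReM.
  by apply: smoothD; [|apply: smoothN]; exact: smoothM.
- under eq_fun do rewrite ImM.
  by apply: smoothD; exact: smoothM.
Qed.

Lemma Csmooth_partial phi k : Csmooth phi -> Csmooth (Cpartial k phi).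
Proof. by move=> [? ?]; split; exact: smooth_partial. Qed.

Lemma Csmooth_conj phi : Csmooth phi -> Csmooth (fun x => (phi x)^*%R).
Proof.
move=> [? ?]; split; first by under eq_fun do rewrite Re_conj.
by under eq_fun do rewrite Im_conj; exact: smoothN.
Qed.

Lemma Cpartial_conj phi k x : Csmooth phi ->
  Cpartial k (fun y => (phi y)^*%R) x = (Cpartial k phi x)^*%R.
Proof.
move=> [_ sf]; rewrite /Cpartial.
rewrite (eq_fun (fun y => Re_conj (phi y))) (eq_fun (fun y => Im_conj (phi y))).
by rewrite partialN.
Qed.

Lemma CpartialM phi psi k x : Csmooth phi -> Csmooth psi ->
  Cpartial k (fun y => phi y * psi y) x =
  Cpartial k phi x * psi x + phi x * Cpartial k psi x.
Proof.
move=> [rf jf] [rg jg]; rewrite /Cpartial.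
rewrite (eq_fun (fun y => ReM (phi y) (psi y))).
rewrite (eq_fun (fun y => ImM (phi y) (psi y))).
have dM f g : smooth f -> smooth g ->
    partial k (fun y => f y * g y) x = f x * partial k g x + g x * partial k f x.
  by move=> sf sg; apply: partialM; exact: smooth_derivable.
rewrite partialB; [|exact: smoothM|exact: smoothM].
rewrite partialD; [|exact/smooth_derivable/smoothM|exact/smooth_derivable/smoothM].
rewrite !dM//; case: (phi x) (psi x) => [a b] [c d] /=.
by congr (_ +i* _); ring.
Qed.

Lemma Cpartial_swap phi k l x : Csmooth phi ->
  Cpartial k (Cpartial l phi) x = Cpartial l (Cpartial k phi) x.
Proof.
move=> [sr si].
exact: (f_equal2 (@Complex R) (partial_swap k l x sr) (partial_swap k l x si)).
Qed.

Definition supp phi : set (R3 R) := closure [set x | phi x != 0].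

Lemma supp_compact phi : test_function phi -> compact (supp phi).
Proof. by case. Qed.

Lemma supp_out phi x : ~ supp phi x -> \forall y \near x, phi y = 0.
Proof.
move=> nx; have : nbhs x (~` supp phi).
  by apply: open_nbhs_nbhs; split=> //; apply: closed_openC; exact: closed_closure.
apply: filterS => y ny; apply/eqP/negPn/negP => phiy.
by apply: ny; exact: subset_closure.
Qed.

(** The complement of the closed support is open, so [phi] is zero on a whole neighbourhood of [x]
    and has there the derivatives of the zero function. *)
Lemma Cpartial_supp0 phi k x : ~ supp phi x -> Cpartial k phi x = 0.
Proof.
move=> /supp_out nx; rewrite /Cpartial /partial.
have -> : 'D_(basis3 R k) (fun y => complex.Re (phi y)) x = 0.
  rewrite (@near_eq_derive _ _ _ _ (cst 0)) ?derive_cst//.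
  by apply: filterS nx => y ->.
have -> : 'D_(basis3 R k) (fun y => complex.Im (phi y)) x = 0.
  rewrite (@near_eq_derive _ _ _ _ (cst 0)) ?derive_cst//.
  by apply: filterS nx => y ->.
by [].
Qed.

Lemma test_functionM phi psi : test_function phi -> Csmooth psi ->
  test_function (fun x => phi x * psi x).
Proof.
move=> tphi spsi.
have [rp ip] := CsmoothM (test_function_Csmooth tphi) spsi; split => //.
apply: subclosed_compact (supp_compact tphi) _; first exact: closed_closure.
by apply: closure_subset => x /=; apply: contra_neq => ->; rewrite mul0r.
Qed.

Lemma test_function0 : test_function (fun=> 0 : R[i]).
Proof.
split; [exact: smooth_cst|exact: smooth_cst|].
rewrite (_ : [set _ | _] = set0) ?closure0; first exact: compact0.
by apply/seteqP; split => x //=; rewrite eqxx.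
Qed.

End smooth_functions.

(** * Borel sets of R^3 *)

Section borel_sets.
Variable R : realType.
Local Notation T3 := (R3 (measurableTypeR R)).
Implicit Types (f : R3 R -> R) (K : set (R3 R)).

(** A countable base of the topology made of measurable rectangles; it links open sets to the
    product sigma-algebra carrying [lebesgue3]. The index packs a rational centre and a rational
    radius. *)
Definition rat_cube (q : (rat * rat * rat) * rat) : set (R3 R) :=
  (ball (ratr q.1.1.1 : R) (ratr q.2) `*` ball (ratr q.1.1.2 : R) (ratr q.2))
   `*` ball (ratr q.1.2 : R) (ratr q.2).

Lemma open_bigcup_rat_cube (A : set (R3 R)) : open A ->
  A = \bigcup_(q in [set q | rat_cube q `<=` A]) rat_cube q.
Proof.
move=> oA; apply/seteqP; split=> [x Ax|x [q /= qA /qA//]].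
have /nbhs_ballP[e /= e0 xeA] : nbhs x A by exact: open_nbhs_nbhs.
(* With a radius below [e / 2], any point of a cube containing [x] is within [e] of [x] in each
   coordinate. *)
have /rat_in_itvoo[r] : 0 < e / 2 by rewrite divr_gt0.
rewrite in_itv /= => /andP[r0 re].
have near_rat (t : R) : exists q : rat, ball (ratr q : R) (ratr r) t.
  have /rat_in_itvoo[q] : t - ratr r < t + ratr r by rewrite ltrD2l gtrN.
  rewrite in_itv /= => /andP[tq qt]; exists q.
  by rewrite /ball /= ltr_distl; apply/andP; split; lra.
have [a xa] := near_rat x.1.1; have [b xb] := near_rat x.1.2.
have [c xc] := near_rat x.2.
exists ((a, b, c), r) => //= y [[ya yb] yc]; apply: xeA.
have tri (q s t : R) : ball q (ratr r) s -> ball q (ratr r) t -> ball s e t.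
  move=> /ball_sym qs qt.
  by apply: (@le_ball _ _ _ (ratr r + ratr r)); [lra|exact: ball_triangle qs qt].
by split; [split; [exact: tri xa ya|exact: tri xb yb]|exact: tri xc yc].
Qed.

Lemma open_measurable3 (A : set (R3 R)) : open A -> measurable (A : set T3).
Proof.
move=> /open_bigcup_rat_cube ->; rewrite bigcup_mkcond.
apply: countable_bigcupT_measurable => [|q]; first exact: countableP.
case: ifPn => // _.
by apply: measurableX; [apply: measurableX|]; rewrite ball_itv; exact: measurable_itv.
Qed.

Lemma compact_measurable3 K : compact K -> measurable (K : set T3).
Proof.
move=> cK; have cl : closed K := compact_closed (@norm_hausdorff _ _) cK.
rewrite -(setCK K); apply: (@measurableC _ T3).
by apply: open_measurable3; exact: closed_openC.
Qed.

Lemma continuous_measurable3 f : continuous f -> measurable_fun [set: T3] f.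
Proof.
move=> /continuousP cf; apply: (measurability _ (RGenOpens.measurableE R)).
move=> _ [_ [a [b ->] <-]]; rewrite setTI.
apply: open_measurable3; apply: cf; exact: interval_open.
Qed.

Lemma continuous_compact_bounded f K : continuous f -> compact K ->
  exists M, forall x, K x -> `|f x| <= M.
Proof.
move=> cf cK.
have /compact_bounded[M [_ HM]] := continuous_compact (continuous_subspaceT cf) cK.
by exists (M + 1) => x Kx; apply: (HM (M + 1)); [rewrite ltrDl|exists x].
Qed.

(** The coordinate functions are bounded on [K], which therefore lies in a box whose measure is a
    product of three finite lengths. *)
Lemma compact_lebesgue3_lty K : compact K -> (@lebesgue3 R K < +oo)%E.
Proof.
move=> cK; have mK := compact_measurable3 cK.
pose I M : set (measurableTypeR R) := `[- M, M]%classic.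
have mI M : measurable (I M) by exact: measurable_itv.
have fI M : (lebesgue_measure (I M) < +oo)%E.
  by rewrite lebesgue_measure_itv /=; case: ifP => // _; rewrite ltey.
have c1 : continuous (fun x : R3 R => x.1.1).
  by move=> x; apply: (@continuous_comp _ _ _ fst fst); exact: cvg_fst.
have c2 : continuous (fun x : R3 R => x.1.2).
  by move=> x; apply: (@continuous_comp _ _ _ fst snd);
    [exact: cvg_fst|exact: cvg_snd].
have c3 : continuous (fun x : R3 R => x.2) by move=> x; exact: cvg_snd.
have [M1 b1] := continuous_compact_bounded c1 cK.
have [M2 b2] := continuous_compact_bounded c2 cK.
have [M3 b3] := continuous_compact_bounded c3 cK.
have KI : K `<=` (I M1 `*` I M2) `*` I M3.
  move=> x Kx; rewrite /I /= !in_itv /= -!ler_norml.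
  by split; [split; [exact: b1|exact: b2]|exact: b3].
apply: (@le_lt_trans _ _ (@lebesgue3 R ((I M1 `*` I M2) `*` I M3))).
  apply: le_measure => //; rewrite inE//.
  by apply: measurableX => //; exact: measurableX.
have -> : @lebesgue3 R ((I M1 `*` I M2) `*` I M3) =
    (lebesgue_measure (I M1) * lebesgue_measure (I M2) * lebesgue_measure (I M3))%E.
  rewrite -(product_measure1E _ _ (mI M1) (mI M2)).
  by apply: product_measure1E => //; exact: measurableX.
rewrite lte_mul_pinfty ?mule_ge0// ge0_fin_numE ?mule_ge0//.
by rewrite lte_mul_pinfty ?ge0_fin_numE.
Qed.

End borel_sets.

(** * Square-integrable functions *)

Section square_integrable.
Context d (T : measurableType d) (R : realType).
Variable mu : {measure set T -> \bar R}.
Implicit Types f g : T -> R.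

(** Stated through integrability of the square rather than through a norm, so that stability under
    sums and products reduces to domination by integrable functions. *)
Definition sqint f := measurable_fun setT f /\
  mu.-integrable setT (EFin \o (fun x => f x ^+ 2)).

Lemma integrable_bounded f g : measurable_fun setT f ->
  mu.-integrable setT (EFin \o g) -> (forall x, `|f x| <= g x) ->
  mu.-integrable setT (EFin \o f).
Proof.
move=> mf ig fg; apply: le_integrable ig => //; first exact/measurable_EFinP.
by move=> x _ /=; rewrite lee_fin (le_trans (fg x))// ler_norm.
Qed.

Lemma integrableDr f g : mu.-integrable setT (EFin \o f) ->
  mu.-integrable setT (EFin \o g) ->
  mu.-integrable setT (EFin \o (fun x => f x + g x)).
Proof. by move=> fi gi; apply: eq_integrable (integrableD _ fi gi). Qed.

Lemma integrableBr f g : mu.-integrable setT (EFin \o f) ->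
  mu.-integrable setT (EFin \o g) ->
  mu.-integrable setT (EFin \o (fun x => f x - g x)).
Proof. by move=> fi gi; apply: eq_integrable (integrableB _ fi gi). Qed.

Lemma integrableZr f (c : R) : mu.-integrable setT (EFin \o f) ->
  mu.-integrable setT (EFin \o (fun x => c * f x)).
Proof. by move=> fi; apply: eq_integrable (integrableZl _ c fi). Qed.

Lemma sqint0 : sqint (fun=> 0).
Proof.
split; first exact: measurable_cst.
by under eq_fun do rewrite /= expr0n; exact: integrable0.
Qed.

(** The product is dominated by [f x ^+ 2 + g x ^+ 2], because the squares of [f x + g x] and
    [f x - g x] are nonnegative. *)
Lemma sqintM f g : sqint f -> sqint g ->
  mu.-integrable setT (EFin \o (fun x => f x * g x)).
Proof.
move=> [mf fi] [mg gi]; apply: (integrable_bounded _ (integrableDr fi gi)).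
  exact: measurable_funM.
move=> x; have := sqr_ge0 (f x + g x); have := sqr_ge0 (f x - g x).
by rewrite ler_norml => ? ?; apply/andP; split; nra.
Qed.

Lemma sqintD f g : sqint f -> sqint g -> sqint (fun x => f x + g x).
Proof.
move=> [mf fi] [mg gi]; split; first exact: measurable_funD.
apply: (integrable_bounded _ (integrableZr 2 (integrableDr fi gi))).
  by apply: measurable_funX; exact: measurable_funD.
by move=> x; rewrite ger0_norm ?sqr_ge0//; have := sqr_ge0 (f x - g x); nra.
Qed.

Lemma sqintN f : sqint f -> sqint (fun x => - f x).
Proof.
move=> [mf fi]; split; first exact: measurableT_comp.
by under eq_fun do rewrite /= sqrrN.
Qed.

Lemma sqintB f g : sqint f -> sqint g -> sqint (fun x => f x - g x).
Proof. by move=> sf /sqintN sg; exact: sqintD. Qed.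

Lemma sqintM_bounded f g (M : R) : sqint f -> measurable_fun setT g ->
  (forall x, `|g x| <= M) -> sqint (fun x => f x * g x).
Proof.
move=> [mf fi] mg gM; split; first exact: measurable_funM.
apply: (integrable_bounded _ (integrableZr (M ^+ 2) fi)).
  by apply: measurable_funX; exact: measurable_funM.
move=> x; rewrite ger0_norm ?sqr_ge0// exprMn mulrC ler_wpM2r ?sqr_ge0//.
by rewrite -[leLHS]real_normK ?num_real// lerXn2r// nnegrE (le_trans _ (gM x)).
Qed.

Lemma sqint_support f (K : set T) (M : R) : measurable K -> (mu K < +oo)%E ->
  measurable_fun setT f -> (forall x, `|f x| <= M) -> (forall x, ~ K x -> f x = 0) ->
  sqint f.
Proof.
move=> mK fK mf fM f0; split => //.
apply: (@integrable_bounded _ (fun x => M ^+ 2 * \1_K x)).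
- exact: measurable_funX.
- apply: integrableZr; apply/integrableP; split.
    by apply/measurable_EFinP; exact: measurable_indic.
  under eq_integral do rewrite /= ger0_norm//.
  by rewrite integral_indic// setIT.
- move=> x; rewrite indicE; case: (boolP (x \in K)) => [|/negP] xK.
    rewrite mulr1 normrX lerXn2r// ?nnegrE//.
    exact: le_trans (fM x).
  by rewrite mulr0 f0 ?expr0n ?normr0// => /mem_set.
Qed.

Lemma Rintegral_eq0_ae f : measurable_fun setT f -> (forall x, 0 <= f x) ->
  mu.-integrable setT (EFin \o f) -> (\int[mu]_x f x)%R = 0 ->
  {ae mu, forall x, f x = 0}.
Proof.
move=> mf f0 fi I0.
have : ae_eq mu setT (EFin \o f) (cst 0%E).
  apply/ae_eq_integral_abs => //; first exact/measurable_EFinP.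
  under eq_integral do rewrite /= ger0_norm//.
  by rewrite -[LHS]fineK ?integrable_fin_num//; congr EFin.
by apply: filterS => x /(_ I) [].
Qed.

End square_integrable.

(** * Orthogonality in L_2(R^3; C^3) *)

Section complex_fields.
Variable R : realType.
Local Notation T3 := (R3 (measurableTypeR R)).
Local Notation mu := (@lebesgue3 R).
Implicit Types (phi psi a b : R3 R -> R[i]) (h g u : field3 R).

Definition Csqint a := sqint mu (fun x => complex.Re (a x)) /\
  sqint mu (fun x => complex.Im (a x)).

Definition Cintegrable a :=
  mu.-integrable setT (EFin \o (fun x => complex.Re (a x))) /\
  mu.-integrable setT (EFin \o (fun x => complex.Im (a x))).

Lemma CsqintB a b : Csqint a -> Csqint b -> Csqint (fun x => a x - b x).
Proof.
by move=> [ra ia] [rb ib]; split; under eq_fun do rewrite raddfB; exact: sqintB.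
Qed.

Lemma Csqint_conj a : Csqint a -> Csqint (fun x => (a x)^*%R).
Proof.
move=> [ra ia]; split; first by under eq_fun do rewrite Re_conj.
by under eq_fun do rewrite Im_conj; exact: sqintN.
Qed.

Lemma CsqintM a b : Csqint a -> Csqint b -> Cintegrable (fun x => a x * b x).
Proof.
move=> [ra ia] [rb ib]; split.
- by under eq_fun do rewrite ReM; apply: integrableBr; exact: sqintM.
- by under eq_fun do rewrite ImM; apply: integrableDr; exact: sqintM.
Qed.

Lemma CintegrableD a b : Cintegrable a -> Cintegrable b ->
  Cintegrable (fun x => a x + b x).
Proof.
by move=> [ra ia] [rb ib]; split; under eq_fun do rewrite raddfD;
  exact: integrableDr.
Qed.

Lemma CintegrableB a b : Cintegrable a -> Cintegrable b ->
  Cintegrable (fun x => a x - b x).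
Proof.
by move=> [ra ia] [rb ib]; split; under eq_fun do rewrite raddfB;
  exact: integrableBr.
Qed.

Lemma CintegralD a b : Cintegrable a -> Cintegrable b ->
  Cintegral (fun x => a x + b x) = Cintegral a + Cintegral b.
Proof.
move=> [ra ia] [rb ib]; rewrite /Cintegral.
rewrite (eq_fun (fun x => raddfD _ (a x) (b x) : complex.Re (_ + _) = _)).
rewrite (eq_fun (fun x => raddfD _ (a x) (b x) : complex.Im (_ + _) = _)).
by rewrite !RintegralD.
Qed.

Lemma CintegralB a b : Cintegrable a -> Cintegrable b ->
  Cintegral (fun x => a x - b x) = Cintegral a - Cintegral b.
Proof.
move=> [ra ia] [rb ib]; rewrite /Cintegral.
rewrite (eq_fun (fun x => raddfB _ (a x) (b x) : complex.Re (_ - _) = _)).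
rewrite (eq_fun (fun x => raddfB _ (a x) (b x) : complex.Im (_ - _) = _)).
by rewrite !RintegralB.
Qed.

Lemma Cintegral0 : Cintegral (fun=> 0 : R[i]) = 0.
Proof. by rewrite /Cintegral /= /Rintegral !integral0. Qed.

(** Integrability and value are proved together, since additivity of the integral at each step of
    the induction uses the integrability of the remaining sum. *)
Lemma Cintegral_sum n (F : 'I_n -> R3 R -> R[i]) :
  (forall k, Cintegrable (F k)) ->
  Cintegrable (fun x => \sum_k F k x) /\
  Cintegral (fun x => \sum_k F k x) = \sum_k Cintegral (F k).
Proof.
elim: n F => [|n IHn] F iF.
  split; last first.
    by under eq_fun do rewrite big_ord0; rewrite big_ord0 Cintegral0.
  under eq_fun do rewrite big_ord0.
  by split; apply: integrable0.
have [I1 I2] := IHn _ (fun k => iF (lift ord0 k)).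
under eq_fun do rewrite big_ord_recl.
by split; [exact: CintegrableD|rewrite CintegralD// I2 big_ord_recl].
Qed.

(** The squared modulus as a real polynomial, free of the square root in [normc]. *)
Definition nsq (z : R[i]) : R := complex.Re z ^+ 2 + complex.Im z ^+ 2.

Definition sqnorm h x : R := \sum_k nsq (h x 0 k).

Lemma nsq_ge0 z : 0 <= nsq z.
Proof. by rewrite addr_ge0 ?sqr_ge0. Qed.

Lemma sqnorm_ge0 h x : 0 <= sqnorm h x.
Proof. by apply: sumr_ge0 => k _; exact: nsq_ge0. Qed.

Lemma L2norm_sqr h : (L2norm h `^ 2 = \int[mu]_x (sqnorm h x)%:E)%E.
Proof.
rewrite /L2norm poweR_Lnorm//; apply: eq_integral => x _ /=.
rewrite powR_mulrn// -normrX ger0_norm ?sqr_ge0// sqr_sqrtr; last first.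
  by apply: sumr_ge0 => k _; exact: sqr_ge0.
congr EFin; apply: eq_bigr => k _; rewrite /nsq; case: (h x 0 k) => c d /=.
by rewrite sqr_sqrtr// addr_ge0 ?sqr_ge0.
Qed.

Lemma integrable_nsq a : Csqint a ->
  mu.-integrable setT (EFin \o (fun x => nsq (a x))).
Proof. by move=> [[_ ?] [_ ?]]; exact: integrableDr. Qed.

Lemma measurable_nsq a : Cmeasurable a ->
  measurable_fun [set: T3] (fun x => nsq (a x)).
Proof. by move=> [? ?]; apply: measurable_funD; exact: measurable_funX. Qed.

Lemma measurable_sqnorm h : (forall k, Cmeasurable (fun x => h x 0 k)) ->
  measurable_fun [set: T3] (sqnorm h).
Proof. by move=> mh; apply: measurable_sum => k; exact: measurable_nsq. Qed.

Lemma integrable_sqnorm h : (forall k, Csqint (fun x => h x 0 k)) ->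
  mu.-integrable setT (EFin \o sqnorm h).
Proof.
move=> sh; rewrite (_ : _ \o _ = fun x => (\sum_(k < 3) (nsq (h x 0 k))%:E)%E).
  2: by apply/funext => x /=; rewrite sumEFin.
by apply: integrable_sum => //= k _; exact: integrable_nsq.
Qed.

Lemma L2_Csqint h : L2 h <-> forall k, Csqint (fun x => h x 0 k).
Proof.
split=> [[mh hfin] k|sh].
- have ih : mu.-integrable setT (EFin \o sqnorm h).
    apply/integrableP; split.
      by apply/measurable_EFinP; apply: measurable_sqnorm.
    under eq_integral do rewrite /= ger0_norm ?sqnorm_ge0//.
    by rewrite -L2norm_sqr; exact: poweR_lty.
  have [mr mi] := mh k.
  have le x : nsq (h x 0 k) <= sqnorm h x.
    rewrite /sqnorm (bigD1 k)//= lerDl sumr_ge0// => j _; exact: nsq_ge0.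
  by split; split=> //; apply: (integrable_bounded _ ih);
    [exact: measurable_funX| |exact: measurable_funX|] => x;
    rewrite ger0_norm ?sqr_ge0// (le_trans _ (le x))// ?lerDl ?lerDr ?sqr_ge0.
- split; first by move=> k; have [[? _] [? _]] := sh k.
  have /integrableP[_] := integrable_sqnorm sh.
  under eq_integral do rewrite /= ger0_norm ?sqnorm_ge0//.
  by rewrite -L2norm_sqr => /lty_poweRy; exact.
Qed.

Lemma L2norm_lt h (e : R) : 0 < e -> L2 h -> (L2norm h < e%:E)%E ->
  \int[mu]_x sqnorm h x <= e ^+ 2.
Proof.
move=> e0 /L2_Csqint sh he; have ih := integrable_sqnorm sh.
rewrite -lee_fin /Rintegral fineK ?integrable_fin_num// -L2norm_sqr.
rewrite -powR_mulrn ?(ltW e0)// -poweR_EFin.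
rewrite gt0_ler_poweR//.
- by rewrite in_itv /= leey Lnorm_ge0.
- by rewrite in_itv /= leey lee_fin ltW.
- exact: ltW.
Qed.

Lemma L2B h g : L2 h -> L2 g -> L2 (fun x => h x - g x).
Proof.
move=> /L2_Csqint sh /L2_Csqint sg; apply/L2_Csqint => k.
by under eq_fun do rewrite !mxE; exact: CsqintB.
Qed.

Lemma L2_0 : L2 (fun=> 0 : 'rV[R[i]]_3).
Proof.
apply/L2_Csqint => k; under eq_fun do rewrite mxE.
by split; exact: sqint0.
Qed.

Lemma L2inner_integrable h g : L2 h -> L2 g ->
  forall k, Cintegrable (fun x => h x 0 k * (g x 0 k)^*%R).
Proof.
move=> /L2_Csqint sh /L2_Csqint sg k; apply: CsqintM => //.
exact: Csqint_conj.
Qed.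

Lemma L2innerBl h h' g : L2 h -> L2 h' -> L2 g ->
  L2inner (fun x => h x - h' x) g = L2inner h g - L2inner h' g.
Proof.
move=> Lh Lh' Lg; rewrite /L2inner -CintegralB; last 2 first.
- by have [] := Cintegral_sum (L2inner_integrable Lh Lg).
- by have [] := Cintegral_sum (L2inner_integrable Lh' Lg).
congr Cintegral; apply/funext => x; rewrite -sumrB.
by apply: eq_bigr => k _; rewrite !mxE mulrBl.
Qed.

Lemma L2innerBr h g g' : L2 h -> L2 g -> L2 g' ->
  L2inner h (fun x => g x - g' x) = L2inner h g - L2inner h g'.
Proof.
move=> Lh Lg Lg'; rewrite /L2inner -CintegralB; last 2 first.
- by have [] := Cintegral_sum (L2inner_integrable Lh Lg).
- by have [] := Cintegral_sum (L2inner_integrable Lh Lg').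
congr Cintegral; apply/funext => x; rewrite -sumrB.
by apply: eq_bigr => k _; rewrite !mxE rmorphB mulrBr.
Qed.

Lemma L2inner0 g : L2inner (fun=> 0) g = 0.
Proof.
rewrite /L2inner -[RHS]Cintegral0; congr Cintegral; apply/funext => x.
by rewrite big1// => k _; rewrite mxE mul0r.
Qed.

(** Expansion of a nonnegative square, with [t = 1] and [t = -1] for the two signs of the product.
    The free weight [e] lets this inequality, once integrated, do the work of Cauchy-Schwarz. *)
Lemma AMGM (x y e : R) : 0 < e -> `|x * y| <= (e * x ^+ 2 + e^-1 * y ^+ 2) / 2.
Proof.
move=> e0; have sq t : 0 <= e^-1 * (e * x + t * y) ^+ 2.
  by rewrite mulr_ge0 ?sqr_ge0 ?invr_ge0 ?ltW.
have E t : e^-1 * (e * x + t * y) ^+ 2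
    = e * x ^+ 2 + 2 * t * (x * y) + t ^+ 2 * (e^-1 * y ^+ 2).
  by field; rewrite gt_eqF.
have := sq 1; have := sq (-1); rewrite !E ler_norml => ? ?.
by apply/andP; split; lra.
Qed.

Lemma Re_mul_conj_le (z w : R[i]) (e : R) : 0 < e ->
  `|complex.Re (z * w^*%R)| <= e * nsq z + e^-1 * nsq w.
Proof.
move=> e0; rewrite ReM Re_conj Im_conj mulrN opprK (le_trans (ler_normD _ _))//.
rewrite (le_trans (lerD (AMGM _ _ e0) (AMGM _ _ e0)))// /nsq.
have := nsq_ge0 z; have := nsq_ge0 w; rewrite /nsq.
have i0 : 0 < e^-1 by rewrite invr_gt0.
by move=> ? ?; nra.
Qed.

Lemma Im_mul_conj_le (z w : R[i]) (e : R) : 0 < e ->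
  `|complex.Im (z * w^*%R)| <= e * nsq z + e^-1 * nsq w.
Proof.
move=> e0; rewrite ImM Re_conj Im_conj mulrN (le_trans (ler_normD _ _))// normrN.
rewrite (le_trans (lerD (AMGM _ _ e0) (AMGM _ _ e0)))// /nsq.
have := nsq_ge0 z; have := nsq_ge0 w; rewrite /nsq.
have i0 : 0 < e^-1 by rewrite invr_gt0.
by move=> ? ?; nra.
Qed.

Lemma Rintegral_le_AMGM h g (e : R) (f : R3 R -> R) : 0 < e -> L2 h -> L2 g ->
  mu.-integrable setT (EFin \o f) ->
  (forall x, `|f x| <= e * sqnorm h x + e^-1 * sqnorm g x) ->
  `|\int[mu]_x f x| <= e * \int[mu]_x sqnorm h x + e^-1 * \int[mu]_x sqnorm g x.
Proof.
move=> e0 /L2_Csqint/integrable_sqnorm ih /L2_Csqint/integrable_sqnorm ig fi lef.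
apply: (le_trans (le_normr_Rintegral _ fi)) => //.
rewrite -!RintegralZl// -RintegralD//; try exact: integrableZr.
apply: le_Rintegral => //.
- exact: integrable_norm fi.
- by apply: integrableDr; exact: integrableZr.
Qed.

Lemma L2inner_le h g (e : R) : 0 < e -> L2 h -> L2 g ->
  `|complex.Re (L2inner h g)| <=
    e * \int[mu]_x sqnorm h x + e^-1 * \int[mu]_x sqnorm g x /\
  `|complex.Im (L2inner h g)| <=
    e * \int[mu]_x sqnorm h x + e^-1 * \int[mu]_x sqnorm g x.
Proof.
move=> e0 Lh Lg; have [[ir ii] _] := Cintegral_sum (L2inner_integrable Lh Lg).
by split; rewrite /L2inner /Cintegral; apply: Rintegral_le_AMGM => // x;
  rewrite raddf_sum /sqnorm !mulr_sumr -big_split (le_trans (ler_norm_sum _ _ _))//;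
  apply: ler_sum => k _; [exact: Re_mul_conj_le|exact: Im_mul_conj_le].
Qed.

Lemma L2inner_self_eq0 g : L2 g -> L2inner g g = 0 ->
  ae_eq mu setT g (fun=> 0).
Proof.
move=> Lg /(congr1 (@complex.Re R)); rewrite /L2inner /Cintegral /= => I0.
have E x : complex.Re (\sum_k g x 0 k * (g x 0 k)^*%R) = sqnorm g x.
  rewrite raddf_sum; apply: eq_bigr => k _ /=.
  by rewrite ReM Re_conj Im_conj mulrN opprK /nsq !expr2.
rewrite (eq_fun E) in I0.
have sg := (L2_Csqint g).1 Lg.
have mg : measurable_fun [set: T3] (sqnorm g) by apply: measurable_sqnorm; case: Lg.
have := Rintegral_eq0_ae mg (sqnorm_ge0 g) (integrable_sqnorm sg) I0.
apply: filterS => x gx0 _.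
apply/matrixP => i k; rewrite ord1 mxE.
have /eqP := psumr_eq0P (fun k _ => nsq_ge0 (g x 0 k)) gx0 (i := k) isT.
rewrite /nsq paddr_eq0 ?sqr_ge0// !sqrf_eq0; case: (g x 0 k) => c d /=.
by move=> /andP[/eqP-> /eqP->].
Qed.

Lemma L2inner_closure_eq0 (A : set (field3 R)) h g :
  A `<=` @L2 R -> L2 h -> (forall f, A f -> L2inner h f = 0) ->
  L2closure A g -> L2inner h g = 0.
Proof.
move=> AL Lh h0 [Lg gA]; set S := \int[mu]_x sqnorm h x.
have S0 : 0 <= S by apply: Rintegral_ge0 => x _; exact: sqnorm_ge0.
(* The weight is taken equal to the distance of approximation: for [f] in [A] within [e] of [g], the
   inner product of [h] with [g] is that with [g - f], hence at most [e * S + e^-1 * e ^+ 2]. *)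
have bound (e : R) : 0 < e ->
    `|complex.Re (L2inner h g)| <= e * (S + 1) /\
    `|complex.Im (L2inner h g)| <= e * (S + 1).
  move=> e0; have [f Af gf] := gA e e0; have Lf := AL _ Af.
  have Ld := L2B Lg Lf.
  have := L2inner_le e0 Lh Ld; rewrite L2innerBr// (h0 f Af) subr0 -/S.
  have := L2norm_lt e0 Ld gf; set D := \int[mu]_x _ => De.
  have De' : e^-1 * D <= e.
    by rewrite -(ler_pM2l e0) mulVKf ?gt_eqF// -expr2.
  by move=> [r i]; split; [apply: le_trans r _|apply: le_trans i _];
    rewrite mulrDr mulr1 lerD2l.
have zero (t : R) : (forall e, 0 < e -> `|t| <= e * (S + 1)) -> t = 0.
  move=> te; apply/eqP; rewrite -normr_le0; apply/ler_addgt0Pr => e e0.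
  rewrite add0r.
  have S1 : 0 < S + 1 by rewrite ltr_wpDl.
  by have := te (e / (S + 1)) (divr_gt0 e0 S1); rewrite divfK// gt_eqF.
have := zero _ (fun e e0 => (bound e e0).1).
have := zero _ (fun e e0 => (bound e e0).2).
by case: (L2inner h g) => c d /= -> ->.
Qed.

Lemma orth_proj_eq0 (A : set (field3 R)) h : A `<=` @L2 R -> A (fun=> 0) ->
  L2 h -> (forall f, A f -> L2inner h f = 0) ->
  ae_eq mu setT (orth_proj (L2closure A) h) (fun=> 0).
Proof.
move=> AL A0 Lh h0.
have hG g : L2closure A g -> L2inner h g = 0 by exact: L2inner_closure_eq0.
rewrite /orth_proj; set B := [set g | _].
(* Without an element of [B], [xget] would return [h]. The zero field belongs to [B] because [h]
   itself is orthogonal to the closure. *)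
have B0 : B (fun=> 0).
  split; last first.
    by move=> k Gk; rewrite L2innerBl ?hG ?L2inner0 ?subr0//; [exact: L2_0|case: Gk].
  split; first exact: L2_0.
  move=> e e0; exists (fun=> 0) => //.
  rewrite /L2norm (_ : _ \o _ = cst 0%E) ?Lnorm0 ?lte_fin//.
  apply/funext => x /=; congr EFin; rewrite /Cnorm3 big1 ?sqrtr0// => k _.
  by rewrite subr0 mxE /= expr0n addr0 sqrtr0 expr0n.
(* The chosen field need not be the witness 0; only its membership in [B] is known, whence a
   conclusion almost everywhere. *)
have [Gg gorth] := xgetPex h (ex_intro _ _ B0).
set g := xget h B in Gg gorth *.
have Lg : L2 g by case: Gg.
apply: L2inner_self_eq0 => //.
have := gorth _ Gg; rewrite L2innerBl// hG// sub0r => /eqP.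
by rewrite oppr_eq0 => /eqP.
Qed.

End complex_fields.

(** * The cross product with a curl-free field *)

Section cross_product.
Variable R : realType.
Implicit Types (phi psi chi tau a b : R3 R -> R[i]) (u : field3 R).
Implicit Types K : set (R3 R).

Lemma CsqintM_bounded a b (M : R) : Csqint a -> Cmeasurable b ->
  (forall x, `|complex.Re (b x)| <= M) -> (forall x, `|complex.Im (b x)| <= M) ->
  Csqint (fun x => a x * b x).
Proof.
move=> [ra ia] [mr mi] rM iM; split.
- under eq_fun do rewrite ReM.
  by apply: sqintB; apply: (@sqintM_bounded _ _ _ _ _ _ M).
- under eq_fun do rewrite ImM.
  by apply: sqintD; apply: (@sqintM_bounded _ _ _ _ _ _ M).
Qed.

Lemma Csmooth_measurable b : Csmooth b -> Cmeasurable b.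
Proof.
by move=> [rb ib]; split; apply: continuous_measurable3; exact: smooth_continuous.
Qed.

Lemma Csmooth_bounded b K : Csmooth b -> compact K -> (forall x, ~ K x -> b x = 0) ->
  exists M, (forall x, `|complex.Re (b x)| <= M) /\
            (forall x, `|complex.Im (b x)| <= M).
Proof.
move=> [rb ib] cK b0.
have [M1 h1] := continuous_compact_bounded (smooth_continuous rb) cK.
have [M2 h2] := continuous_compact_bounded (smooth_continuous ib) cK.
(* Absolute values, because [M1] and [M2] carry no sign information when [K] is empty, while off [K]
   the bound must be nonnegative. *)
exists (`|M1| + `|M2|); split=> x; (have [Kx|nKx] := pselect (K x);
  last by rewrite b0//= normr0 addr_ge0).
- by rewrite (le_trans (h1 x Kx))// (le_trans (ler_norm _))// lerDl.
- by rewrite (le_trans (h2 x Kx))// (le_trans (ler_norm _))// lerDr.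
Qed.

Lemma Csqint_compact b K : Csmooth b -> compact K -> (forall x, ~ K x -> b x = 0) ->
  Csqint b.
Proof.
move=> sb cK b0; have [M [rM iM]] := Csmooth_bounded sb cK b0.
have [mr mi] := Csmooth_measurable sb.
have mK := compact_measurable3 cK; have fK := compact_lebesgue3_lty cK.
by split; apply: (sqint_support mK fK) => // x /b0 ->.
Qed.

(** As [b] vanishes off [K], [u] may be replaced by its truncation to [K], which is in [L2].
    Boundedness of [b] gives the first claim, used for [L2_cross]; its square-integrability gives
    the second, used for [dist_curlE]. *)
Lemma L2locM u b K (j : 'I_3) : L2loc u -> Csmooth b -> compact K ->
  (forall x, ~ K x -> b x = 0) ->
  Csqint (fun x => u x 0 j * b x) /\ Cintegrable (fun x => u x 0 j * b x).
Proof.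
move=> uloc sb cK b0; have /L2_Csqint/(_ j) sK := uloc K cK.
have [M [rM iM]] := Csmooth_bounded sb cK b0.
have -> : (fun x => u x 0 j * b x) = (fun x => patch (fun=> 0) K u x 0 j * b x).
  apply/funext => x; rewrite /patch; case: ifPn => // /negP xK.
  by rewrite b0 ?mulr0// => /mem_set.
split; first by apply: (CsqintM_bounded _ _ rM iM) => //; exact: Csmooth_measurable.
by apply: CsqintM => //; exact: Csqint_compact cK b0.
Qed.

Lemma L2_grad phi : test_function phi -> L2 (grad phi).
Proof.
move=> tphi; apply/L2_Csqint => k; under eq_fun do rewrite mxE.
apply: (Csqint_compact _ (supp_compact tphi)) => [|x]; last exact: Cpartial_supp0.
exact/Csmooth_partial/test_function_Csmooth.
Qed.

Lemma G0_L2 : @G0 R `<=` @L2 R.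
Proof. by move=> _ [phi tphi <-]; exact: L2_grad. Qed.

Lemma G0_0 : @G0 R (fun=> 0).
Proof.
exists (fun=> 0); first exact: test_function0.
apply/funext => x; apply/matrixP => i k; rewrite !mxE /Cpartial /=.
by rewrite !partial_cst.
Qed.

Lemma L2_cross u phi : L2loc u -> test_function phi ->
  L2 (fun x => cross (u x) (grad phi x)).
Proof.
move=> uloc tphi; apply/L2_Csqint => k; under eq_fun do rewrite !mxE.
have su i j : Csqint (fun x => u x 0 i * Cpartial j phi x).
  apply: (L2locM _ uloc _ (supp_compact tphi) _).1.
    exact/Csmooth_partial/test_function_Csmooth.
  by move=> x; exact: Cpartial_supp0.
by apply: CsqintB.
Qed.

(** The sign in [dist_partial] exchanges the two terms: [F] is the bilinear dot product of [u] with
    the curl of the field whose only nonzero component is [tau], in position [k]. *)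
Lemma dist_curlE u k tau : L2loc u -> test_function tau ->
  let F := fun x => u x 0 (k + 1) * Cpartial (k + 2) tau x
                  - u x 0 (k + 2) * Cpartial (k + 1) tau x in
  Cintegrable F /\ dist_curl u k tau = Cintegral F.
Proof.
move=> uloc ttau.
have iu i j : Cintegrable (fun x => u x 0 i * Cpartial j tau x).
  apply: (L2locM _ uloc _ (supp_compact ttau) _).2.
    exact/Csmooth_partial/test_function_Csmooth.
  by move=> x; exact: Cpartial_supp0.
split; first exact: CintegrableB.
by rewrite CintegralB// /dist_curl /dist_partial opprK addrC.
Qed.

Lemma sum3E (V : nmodType) (F : 'I_3 -> V) : \sum_k F k = F 0 + F 1 + F 2.
Proof.
rewrite !big_ord_recl big_ord0 addr0 addrA.
by congr (F _ + F _ + F _); exact: val_inj.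
Qed.

(** By the Leibniz rule the right-hand side has terms with first derivatives only, which form the
    triple product on the left, and terms with second derivatives of [chi], which cancel in pairs by
    symmetry. The summand of index [k] is the [F] of [dist_curlE] for the product of [phi] and
    [Cpartial k chi]. *)
Lemma cross_grad_curl (u : 'rV[R[i]]_3) phi chi x : Csmooth phi -> Csmooth chi ->
  \sum_k cross u (grad phi x) 0 k * Cpartial k chi x =
  \sum_k (u 0 (k + 1) * Cpartial (k + 2) (fun y => phi y * Cpartial k chi y) x
        - u 0 (k + 2) * Cpartial (k + 1) (fun y => phi y * Cpartial k chi y) x).
Proof.
move=> sphi schi.
(* The derivatives are made opaque: unifying distinct ones unfolds their
   definition, at a prohibitive cost. *)
have [D [DE Dsym]] : exists D : 'I_3 -> 'I_3 -> R[i],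
    (forall k l, Cpartial l (Cpartial k chi) x = D k l) /\ forall k l, D k l = D l k.
  exists (fun k l => Cpartial l (Cpartial k chi) x); split=> k l; first by [].
  exact: Cpartial_swap.
have [p pE] : exists p, forall k, Cpartial k phi x = p k.
  by exists (fun k => Cpartial k phi x).
have [c cE] : exists c, forall k, Cpartial k chi x = c k.
  by exists (fun k => Cpartial k chi x).
have pM k l : Cpartial l (fun y => phi y * Cpartial k chi y) x =
    p l * c k + phi x * D k l.
  by rewrite (CpartialM l x sphi (Csmooth_partial k schi)) pE cE DE.
under eq_bigr do rewrite !mxE !pE cE.
under [RHS]eq_bigr do rewrite !pM.
move: (phi x) => z {pM DE pE cE}.
rewrite !sum3E.
have -> : (0 + 1 : 'I_3) = 1 by exact: val_inj.
have -> : (0 + 2 : 'I_3) = 2 by exact: val_inj.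
have -> : (1 + 1 : 'I_3) = 2 by exact: val_inj.
have -> : (1 + 2 : 'I_3) = 0 by exact: val_inj.
have -> : (2 + 1 : 'I_3) = 0 by exact: val_inj.
have -> : (2 + 2 : 'I_3) = 1 by exact: val_inj.
rewrite (Dsym 1 0) (Dsym 2 0) (Dsym 2 1).
move: (D 0 1) (D 0 2) (D 1 2) (p 0) (p 1) (p 2) (c 0) (c 1) (c 2).
move: (u 0 0) (u 0 1) (u 0 2).
by move=> u0 u1 u2 c01 c02 c12 p0 p1 p2 c0 c1 c2; ring.
Qed.

Lemma curl_free_cross_orth u phi psi : L2loc u -> curl_free u ->
  test_function phi -> test_function psi ->
  L2inner (fun x => cross (u x) (grad phi x)) (grad psi) = 0.
Proof.
move=> uloc ucurl tphi tpsi.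
(* [L2inner] conjugates its second argument; conjugation commutes with the partials, so the
   conjugate of [grad psi] is [grad chi] and the bilinear identity applies. *)
pose chi x := (psi x)^*%R.
have spsi := test_function_Csmooth tpsi; have sphi := test_function_Csmooth tphi.
have schi : Csmooth chi := Csmooth_conj spsi.
have ttau k : test_function (fun y => phi y * Cpartial k chi y).
  exact: test_functionM tphi (Csmooth_partial k schi).
rewrite /L2inner; under eq_fun => x.
  under eq_bigr => k _ do rewrite [grad psi x 0 k]mxE -Cpartial_conj//.
  rewrite (cross_grad_curl (u x) x sphi schi).
  over.
rewrite (Cintegral_sum (fun k => (dist_curlE k uloc (ttau k)).1)).2.
by apply: big1 => k _; rewrite -(dist_curlE k uloc (ttau k)).2 ucurl.
Qed.

End cross_product.

Theorem theorem1 (R : realType) (u : field3 R) :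
  L2loc u -> curl_free u ->
  forall f : field3 R, G0 f ->
    ae_eq (@lebesgue3 R) setT (I_ u f) (fun=> 0).
Proof.
move=> uloc ucurl _ [phi tphi <-].
apply: orth_proj_eq0 => [|||_ [psi tpsi <-]].
- exact: G0_L2.
- exact: G0_0.
- exact: L2_cross.
- exact: curl_free_cross_orth.
Qed.
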